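(* Let $\mathcal{F}$ be a singular foliation at $(\mathbb{C}^2,p)$ and let $B:f(x,y)=0$ be a separatrix of $\mathcal{F}$. Then $$\mu_p(\mathcal{F},B)=\begin{cases}GSV_p(\mathcal{F},B)+\mathrm{ord}_t\,\partial_yf(\gamma(t))-\mathrm{ord}_t\,x(t)+1 & \text{if } x(t)\neq0;\\ GSV_p(\mathcal{F},B)+\mathrm{ord}_t\,\partial_xf(\gamma(t))-\mathrm{ord}_t\,y(t)+1 & \text{if } y(t)\neq0,\end{cases}$$ where $\gamma(t)=(x(t),y(t))$ is a Puiseux parametrization of $B$ (and $x(t)\ne0$, $y(t)\neq 0$ mean not identically zero). In particular, if $B$ is a non-singular separatrix, then $\mu_p(\mathcal{F},B)=GSV_p(\mathcal{F},B)$.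
   Context: **Foliations.** A singular foliation $\mathcal F$ at $(\mathbb C^2,p)$ is given, in coordinates $(x,y)$ centered at $p$, by a (holomorphic or formal) 1-form $\omega=P\,dx+Q\,dy$ with $P,Q\in\mathbb C[[x,y]]$ relatively prime and vanishing at $p$, or by the dual vector field $v=-Q\,\partial_x+P\,\partial_y$. $i_p(g,h)=\dim_{\mathbb C}\mathbb C[[x,y]]/(g,h)$. A curve $f=0$ is $\mathcal F$-invariant if $\omega\wedge df=fh\,dx\wedge dy$ for some $h\in\mathbb C[[x,y]]$. A separatrix is an irreducible (possibly formal) invariant curve, with $f$ a reduced equation. **Multiplicity along a separatrix.** For a separatrix $B$ with primitive parametrization $\gamma(t)=(x(t),y(t))$, $\mu_p(\mathcal F,B)=\mathrm{ord}_t\theta(t)$ where $\theta$ is the unique vector field on $(\mathbb C,0)$ with $\gamma_*\theta(t)=v\circ\gamma(t)$; i.e. $\theta(t)=-Q(\gamma(t))/x'(t)$ if $x(t)\not\equiv0$, and $\theta(t)=P(\gamma(t))/y'(t)$ if $y(t)\not\equiv0$. **GSV-index.** For a separatrix $B:f=0$ there are $g,h\in\mathbb C[[x,y]]$, each relatively prime to $f$, and a 1-form $\eta$ with $g\omega=h\,df+f\eta$; then $GSV_p(\mathcal F,B)=i_p(f,h)-i_p(f,g)$. *)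

(* Defs.v *)
From HB Require Import structures.
From mathcomp Require Import all_boot all_order all_algebra.
From mathcomp Require Import all_classical.
From mathcomp Require Import reals constructive_ereal.
From mathcomp Require Import complex.

Set Implicit Arguments.
Unset Strict Implicit.
Unset Printing Implicit Defensive.

Import Order.TTheory GRing.Theory Num.Theory.
Local Open Scope classical_set_scope.
Local Open Scope ring_scope.

(* A wrapper around nat -> R, because functions already carry the pointwise
   ring structure. *)
Record fps (R : Type) := Fps { fps_coef :> nat -> R }.
Arguments Fps {R}.

(* K[[x,y]] is realized as K[[x]][[y]]: the coefficient of x^i y^j in f is
   f j i. *)
Notation fps2 K := (fps (fps K)).

Lemma fpsP (R : Type) (a b : fps R) : a =1 b <-> a = b.
Proof.
split=> [|-> //]; case: a b => [a] [b] /= ab.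
by congr Fps; apply/funext.
Qed.

HB.instance Definition _ (R : Type) := gen_eqMixin (fps R).
HB.instance Definition _ (R : Type) := gen_choiceMixin (fps R).

Section Ring.
Variable R : comNzRingType.
Implicit Types a b c : fps R.

Definition fps_zero : fps R := Fps (fun _ => 0).
Definition fps_opp a : fps R := Fps (fun n => - a n).
Definition fps_add a b : fps R := Fps (fun n => a n + b n).

Lemma fps_addA : associative fps_add.
Proof. by move=> a b c; apply/fpsP => n /=; rewrite addrA. Qed.
Lemma fps_addC : commutative fps_add.
Proof. by move=> a b; apply/fpsP => n /=; rewrite addrC. Qed.
Lemma fps_add0 : left_id fps_zero fps_add.
Proof. by move=> a; apply/fpsP => n /=; rewrite add0r. Qed.
Lemma fps_addN : left_inverse fps_zero fps_opp fps_add.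
Proof. by move=> a; apply/fpsP => n /=; rewrite addNr. Qed.

HB.instance Definition _ := GRing.isZmodule.Build (fps R)
  fps_addA fps_addC fps_add0 fps_addN.

Definition fpsC (c : R) : fps R := Fps (fun n => if n is 0 then c else 0).
Definition fps_mul a b : fps R :=
  Fps (fun n => \sum_(i < n.+1) a i * b (n - i)%N).

Definition fps_trunc n a : {poly R} := \poly_(i < n) a i.

Lemma fps_mul_trunc n a b i : (i < n)%N ->
  fps_mul a b i = (fps_trunc n a * fps_trunc n b)`_i.
Proof.
move=> lt_in; rewrite coefM; apply: eq_bigr => j _.
rewrite !coef_poly (leq_ltn_trans _ lt_in) 1?(leq_ltn_trans _ lt_in) //.
  exact: leq_subr.
by rewrite -ltnS.
Qed.

Lemma fps_mulC : commutative fps_mul.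
Proof.
by move=> a b; apply/fpsP => n; rewrite !(fps_mul_trunc _ _ (ltnSn n)) mulrC.
Qed.

Lemma fps_mulA : associative fps_mul.
Proof.
move=> a b c; apply/fpsP => n.
transitivity ((fps_trunc n.+1 a * fps_trunc n.+1 b * fps_trunc n.+1 c)`_n).
  rewrite -mulrA coefM; apply: eq_bigr => i _.
  rewrite coef_poly ltn_ord; congr (_ * _).
  by rewrite -fps_mul_trunc // ltnS leq_subr.
rewrite coefM; apply: eq_bigr => i _.
by rewrite -fps_mul_trunc // coef_poly ltnS leq_subr.
Qed.

Lemma fps_mul1 : left_id (fpsC 1) fps_mul.
Proof.
move=> a; apply/fpsP => n /=.
rewrite big_ord_recl /= mul1r subn0 big1 ?addr0 // => i _.
by rewrite mul0r.
Qed.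

Lemma fps_mulDl : left_distributive fps_mul fps_add.
Proof.
move=> a b c; apply/fpsP => n /=.
by rewrite -big_split /=; apply: eq_bigr => i _; rewrite mulrDl.
Qed.

Lemma fps_oner_neq0 : fpsC 1 != 0.
Proof.
by apply/eqP => /fpsP /(_ 0%N) /= /eqP; rewrite oner_eq0.
Qed.

HB.instance Definition _ := GRing.Zmodule_isComNzRing.Build (fps R)
  fps_mulA fps_mulC fps_mul1 fps_mulDl fps_oner_neq0.

Definition fps_unit : {pred fps R} := [pred a | `[< exists b, b * a = 1 >]].
Definition fps_inv a : fps R := xget a [set b | b * a = 1].

Lemma fps_mulVx : {in fps_unit, left_inverse 1 fps_inv *%R}.
Proof.
move=> a /asboolP [b ba1].
by rewrite /fps_inv; case: xgetP => [c _ //|/(_ b)].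
Qed.
Lemma fps_unitPl a b : b * a = 1 -> fps_unit a.
Proof. by move=> ba1; apply/asboolP; exists b. Qed.
Lemma fps_inv_out : {in [predC fps_unit], fps_inv =1 id}.
Proof.
move=> a /asboolP nua; rewrite /fps_inv; case: xgetP => // b _ ba1.
by case: nua; exists b.
Qed.

HB.instance Definition _ := GRing.ComNzRing_hasMulInverse.Build (fps R)
  fps_mulVx fps_unitPl fps_inv_out.

Definition fps_deriv a : fps R := Fps (fun n => a n.+1 *+ n.+1).

(* The order is +oo exactly when a = 0. *)
Definition fps_ord a : \bar int :=
  xget +oo%E [set d | exists n : nat,
    [/\ d = (n%:Z)%:E, a n != 0 & forall m, (m < n)%N -> a m = 0]].

(* a(b(t)), meaningful when b 0 = 0: then b^i has order >= i, so the terms with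
   i > n do not contribute to the coefficient of t^n. *)
Definition fps_comp a b : fps R :=
  Fps (fun n => \sum_(i < n.+1) a i * (b ^+ i) n).

End Ring.

Section Divisibility.
Variable A : comUnitRingType.

Definition relatively_prime (a b : A) : Prop :=
  forall d u v, a = d * u -> b = d * v -> d \is a GRing.unit.

(* This forces f != 0, as 0 = 0 * 0. *)
Definition irreducible_elt (f : A) : Prop :=
  f \isn't a GRing.unit /\
  forall u v, f = u * v -> u \is a GRing.unit \/ v \is a GRing.unit.

End Divisibility.

Section TwoVariables.
Variable K : fieldType.
Implicit Types f g h : fps2 K.

Definition value0 f : K := f 0%N 0%N.

Definition dx f : fps2 K := Fps (fun j => fps_deriv (f j)).
Definition dy f : fps2 K := fps_deriv f.

(* The images of the e_i form a K-basis of K[[x,y]]/(g,h). *)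
Definition quotient_basis g h n (e : 'I_n -> fps2 K) : Prop :=
  forall a, exists! c : 'rV[K]_n, exists u v,
    a = \sum_(i < n) fpsC (fpsC (c 0 i)) * e i + (u * g + v * h).

(* i_p(g,h) = dim K[[x,y]]/(g,h), equal to +oo if this is infinite. *)
Definition intersection_number g h : \bar int :=
  xget +oo%E [set d | exists (n : nat) (e : 'I_n -> fps2 K),
    d = (n%:Z)%:E /\ quotient_basis g h e].

(* A formal curve t |-> (x(t), y(t)). *)
Definition formal_arc : Type := (fps K * fps K)%type.
Definition centered (gamma : formal_arc) : Prop :=
  gamma.1 0%N = 0 /\ gamma.2 0%N = 0.

(* f(x(t), y(t)), meaningful for a centered arc (see fps_comp). *)
Definition pullback f (gamma : formal_arc) : fps K :=
  Fps (fun n => \sum_(j < n.+1) \sum_(i < n.+1)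
    f j i * (gamma.1 ^+ i * gamma.2 ^+ j) n).

(* gamma parametrizes the branch f = 0, and is primitive: it is not obtained
   from another arc by a substitution t |-> tau(t) of order > 1. *)
Definition primitive_parametrization f (gamma : formal_arc) : Prop :=
  [/\ centered gamma, gamma != (0, 0), pullback f gamma = 0
    & forall (delta : formal_arc) (tau : fps K), centered delta -> tau 0%N = 0 ->
        gamma = (fps_comp delta.1 tau, fps_comp delta.2 tau) ->
        fps_ord tau = 1%E].

(* The foliation at the origin given by omega = P dx + Q dy, with dual vector
   field v = - Q d/dx + P d/dy. *)
Record foliation := Foliation {
  fol_P : fps2 K;
  fol_Q : fps2 K;
  fol_coprime : relatively_prime fol_P fol_Q;
  fol_P0 : value0 fol_P = 0;
  fol_Q0 : value0 fol_Q = 0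
}.

Variable F : foliation.
Let P := fol_P F.
Let Q := fol_Q F.

(* omega /\ df = f h dx /\ dy *)
Definition invariant f : Prop :=
  exists h, P * dy f - Q * dx f = f * h.

Definition separatrix f : Prop := irreducible_elt f /\ invariant f.

(* gamma_* theta = v o gamma, where theta stands for theta(t) d/dt *)
Definition lifts_field (gamma : formal_arc) (theta : fps K) : Prop :=
  theta * fps_deriv gamma.1 = - pullback Q gamma /\
  theta * fps_deriv gamma.2 = pullback P gamma.

(* mu_p(F,B) for B : f = 0. The lift theta is unique, and its order does not
   depend on the primitive parametrization. *)
Definition multiplicity_along f : \bar int :=
  let gamma := xget (0, 0) [set gamma | primitive_parametrization f gamma] in
  fps_ord (xget 0 [set theta | lifts_field gamma theta]).

(* g omega = h df + f eta, with eta = eta1 dx + eta2 dy *)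
Definition gsv_decomposition f g h : Prop :=
  [/\ relatively_prime g f, relatively_prime h f
    & exists eta1 eta2, g * P = h * dx f + f * eta1 /\
                        g * Q = h * dy f + f * eta2].

(* GSV_p(F,B) for B : f = 0; the value does not depend on the decomposition. *)
Definition gsv_index f : \bar int :=
  let gh := xget (0, 0) [set gh | gsv_decomposition f gh.1 gh.2] in
  (intersection_number f gh.2 - intersection_number f gh.1)%E.

End TwoVariables.

Definition nonsingular (K : fieldType) (f : fps2 K) : Prop :=
  value0 (dx f) != 0 \/ value0 (dy f) != 0.

(* Main.v *)
Require Import Defs.
From HB Require Import structures.
From mathcomp Require Import all_boot all_order all_algebra.
From mathcomp Require Import all_classical.
From mathcomp Require Import reals constructive_ereal.
From mathcomp Require Import complex.
From mathcomp Require Import zify ring.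

Set Implicit Arguments.
Unset Strict Implicit.
Unset Printing Implicit Defensive.

Import Order.TTheory GRing.Theory Num.Theory.
Local Open Scope ring_scope.

(** Let [gamma = (x, y)] be a primitive arc of the branch [f = 0].  The proof
    rests on the equality of the intersection number [i(f, g)] with the order
    of [g] along [gamma].  Given that, the formula is a comparison of orders.
    A decomposition [g omega = h df + f eta] restricts to the branch as
    [g P = h f_x] and [g Q = h f_y].  With [theta x' = - Q] and [theta y' = P]
    this becomes [g theta x' = - h f_y] and [g theta y' = h f_x], and
    [ord h - ord g] is the GSV-index while [ord x' = ord x - 1].  The lift
    [theta] exists because both the field and the velocity of the arc are
    annihilated by [df], and the components of the field vanish at the origin
    ([field_lifts]).  A decomposition is given by [g = f_y], [h = Q], or by
    [g = f_x], [h = P] ([decomposition_exists]).  Intersection numbers do not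
    refer to the arc, so all primitive arcs yield the same orders.

    The equality of intersection numbers with orders
    ([intersection_number_order]) has two ingredients.

    First, a series vanishing on the arc is a multiple of [f] ([pull_kernel]).
    The ideal of these series is principal by Weierstrass division, and its
    generator divides the irreducible [f].  Weierstrass division itself is
    division by the constant coefficient, iterated ([fps_division]); it also
    gives the inverses of series and the implicit function theorem.

    Second, the ring [A] of restrictions to the arc contains all series of
    high order ([primitive_conductor]).  The quotients of elements of [A] that
    are series form a discrete valuation ring, whose elements are series in a
    uniformizer.  As the arc is primitive, the uniformizer has order one.
    Writing all series as polynomials in it with coefficients in
    the series in one coordinate, again by Weierstrass division, and clearing
    denominators yields a conductor.

    Then [A] and [h A] have the same codimension in the series ring and in its
    multiples of [h], respectively, so that [A / h A] has dimension [ord h].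

    Limits do not appear: two series defined by iteration are equal because
    their difference is divisible by all powers of the variable
    ([vanishing_family]). *)

(** * Formal power series: orders, derivation, substitution *)

Section SeriesRing.
Variable R : comNzRingType.
Implicit Types a b z : fps R.

Definition fpsX : fps R := Fps (fun n => (n == 1%N)%:R).
Definition fps_drop n a : fps R := Fps (fun k => a (n + k)%N).

Definition vanishes n a := forall m, (m < n)%N -> a m = 0.
Definition has_order a n := a n != 0 /\ vanishes n a.

Lemma fps_coefM a b n : (a * b) n = \sum_(i < n.+1) a i * b (n - i)%N.
Proof. by []. Qed.

Lemma fps_coef0M a b : (a * b) 0%N = a 0%N * b 0%N.
Proof. by rewrite fps_coefM big_ord1. Qed.

Lemma fps_coef_sum n I (r : seq I) (P : pred I) (F : I -> fps R) :
  (\sum_(i <- r | P i) F i) n = \sum_(i <- r | P i) F i n.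
Proof. exact: (big_morph (fun a : fps R => a n)). Qed.

Lemma fps_coefD a b n : (a + b) n = a n + b n. Proof. by []. Qed.
Lemma fps_coefB a b n : (a - b) n = a n - b n. Proof. by []. Qed.

Lemma fps_coefMn a k n : (a *+ k) n = a n *+ k.
Proof. by elim: k => // k IHk; rewrite !mulrS fps_coefD IHk. Qed.

Lemma fpsC_coefM c a n : (fpsC c * a) n = c * a n.
Proof.
by rewrite fps_coefM big_ord_recl subn0 big1 ?addr0 // => i _; rewrite mul0r.
Qed.

Lemma fpsC_is_nmod : nmod_morphism (@fpsC R).
Proof.
by split=> [|c d]; apply/fpsP => -[|n] //=; rewrite ?addr0.
Qed.
Lemma fpsC_is_monoid : monoid_morphism (@fpsC R).
Proof.
split=> // c d; apply/fpsP => n; rewrite fpsC_coefM.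
by case: n => //= n; rewrite mulr0.
Qed.
HB.instance Definition _ :=
  GRing.isNmodMorphism.Build R (fps R) (@fpsC R) fpsC_is_nmod.
HB.instance Definition _ :=
  GRing.isMonoidMorphism.Build R (fps R) (@fpsC R) fpsC_is_monoid.

Lemma fpsX_coefM0 a : (fpsX * a) 0%N = 0.
Proof. by rewrite fps_coef0M mul0r. Qed.

Lemma fpsX_coefMS a n : (fpsX * a) n.+1 = a n.
Proof.
rewrite fps_coefM big_ord_recl mul0r add0r big_ord_recl /= subn1 mul1r.
by rewrite big1 ?addr0 // => i _; rewrite mul0r.
Qed.

Lemma fpsXn_coefM a k n :
  (fpsX ^+ k * a) n = if (n < k)%N then 0 else a (n - k)%N.
Proof.
elim: k n => [|k IHk] n; first by rewrite mul1r ltn0 subn0.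
rewrite exprS -mulrA; case: n => [|n]; first by rewrite fpsX_coefM0.
by rewrite fpsX_coefMS IHk.
Qed.

Lemma fps_split a : a = fpsC (a 0%N) + fpsX * fps_drop 1 a.
Proof.
apply/fpsP => -[|n]; rewrite -[RHS]/(_ + _ : R).
  by rewrite fpsX_coefM0 addr0.
by rewrite fpsX_coefMS add0r.
Qed.

Lemma vanishesE n a : vanishes n a -> a = fpsX ^+ n * fps_drop n a.
Proof.
move=> va; apply/fpsP => k; rewrite fpsXn_coefM /=.
by case: ltnP => [/va //|le_nk]; rewrite subnKC.
Qed.

Lemma vanishesXn n a : vanishes n (fpsX ^+ n * a).
Proof. by move=> m lt_mn; rewrite fpsXn_coefM lt_mn. Qed.

Lemma vanishesW m n a : (m <= n)%N -> vanishes n a -> vanishes m a.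
Proof. by move=> le_mn va k lt_km; apply/va/(leq_trans lt_km). Qed.

Lemma vanishesD n a b : vanishes n a -> vanishes n b -> vanishes n (a + b).
Proof.
by move=> va vb m lt_mn; rewrite -[LHS]/(_ + _ : R) va ?vb ?addr0.
Qed.

Lemma vanishesM m n a b :
  vanishes m a -> vanishes n b -> vanishes (m + n) (a * b).
Proof.
move=> /vanishesE-> /vanishesE->; rewrite mulrACA -exprD.
exact: vanishesXn.
Qed.

Lemma vanishes_exp z j : z 0%N = 0 -> vanishes j (z ^+ j).
Proof.
move=> z0; elim: j => [|j IHj] //.
by rewrite exprS -add1n; apply: vanishesM => // -[].
Qed.

Lemma coefM_order m n a b : vanishes m a -> vanishes n b ->
  (a * b) (m + n)%N = a m * b n.
Proof.
move=> va vb; rewrite {1}(vanishesE va) {1}(vanishesE vb) mulrACA -exprD.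
by rewrite fpsXn_coefM ltnn subnn fps_coef0M /= !addn0.
Qed.

Lemma has_order_uniq a m n : has_order a m -> has_order a n -> m = n.
Proof.
move=> [am va] [an vb]; case: (ltngtP m n) => // [lt_mn | lt_nm].
  by rewrite vb ?eqxx in am.
by rewrite va ?eqxx in an.
Qed.

Lemma has_order_exists a : a != 0 -> exists n, has_order a n.
Proof.
move=> a_neq0; have [n an] : exists n, a n != 0.
  apply: contrapT => a0; case/eqP: a_neq0; apply/fpsP => n.
  by apply: contrapT => an; case: a0; exists n; apply/eqP.
case: (ex_minnP (ex_intro (fun n => a n != 0) n an)) => m am m_min.
exists m; split=> // k lt_km; apply/eqP; apply: contraTT lt_km.
by rewrite -leqNgt; apply: m_min.
Qed.

Lemma has_order_neq0 a n : has_order a n -> a != 0.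
Proof. by case=> an _; apply: contraNneq an => ->. Qed.

Lemma fps_ordE a n : has_order a n -> fps_ord a = n%:Z%:E.
Proof.
move=> an; rewrite /fps_ord; case: xgetP => [_ -> [m [-> am va]]|/(_ n%:Z%:E)].
  by rewrite (has_order_uniq an (conj am va)).
by case: an => an va; case; exists n.
Qed.

Lemma has_orderP a n : fps_ord a = n%:Z%:E -> has_order a n.
Proof.
rewrite /fps_ord; case: xgetP => // _ -> [m [-> am va]] [mn].
by rewrite -mn.
Qed.

Lemma has_order0 a : a 0%N != 0 -> has_order a 0.
Proof. by split. Qed.

(** Every element of the family is congruent to zero modulo all powers of the
    variable, since each is so to one order more than all of them are.  This
    replaces all convergence arguments: a series defined by iterating a
    one-step equation solves the equation because the defect of the solution
    is a family of this kind. *)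
Lemma vanishing_family (T : Type) (E : T -> fps R) :
  (forall n, (forall y, vanishes n (E y)) -> forall x, vanishes n.+1 (E x)) ->
  forall x, E x = 0.
Proof.
move=> step x; suff vE n y : vanishes n (E y) by apply/fpsP => n; apply: vE.
by elim: n y => [//|n IHn] y; apply: step.
Qed.

Lemma contracting_family (T : Type) (E : T -> fps R) z : z 0%N = 0 ->
  (forall x, exists y, E x = z * E y) -> forall x, E x = 0.
Proof.
move=> z0 step; apply: vanishing_family => n vE x.
have [y ->] := step x; rewrite -add1n; apply: vanishesM; last exact: vE.
by case.
Qed.

End SeriesRing.

Arguments fpsX {R}.

Section SeriesDomain.
Variable R : idomainType.
Implicit Types a b : fps R.

Lemma has_orderM a b m n :
  has_order a m -> has_order b n -> has_order (a * b) (m + n).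
Proof.
move=> [am va] [bn vb]; split; last exact: vanishesM.
by rewrite coefM_order // mulf_neq0.
Qed.

Lemma fps_integral a b : a * b = 0 -> (a == 0) || (b == 0).
Proof.
move=> ab0; apply: contraT; rewrite negb_or => /andP[].
move=> /has_order_exists[m am] /has_order_exists[n bn].
by have /has_order_neq0 := has_orderM am bn; rewrite ab0 eqxx.
Qed.

HB.instance Definition _ :=
  GRing.ComUnitRing_isIntegral.Build (fps R) fps_integral.

Lemma fpsX_neq0 : (fpsX : fps R) != 0.
Proof. by apply: (@has_order_neq0 _ _ 1%N); split=> [|[]]; rewrite ?oner_neq0. Qed.

Lemma vanishes_order a m n : has_order a m -> vanishes n a -> (n <= m)%N.
Proof. by case=> am _ va; apply: contraNT am; rewrite -ltnNge => /va ->. Qed.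

End SeriesDomain.

Section Derivation.
Variable R : comNzRingType.
Implicit Types a b : fps R.

Lemma fps_deriv_is_nmod : nmod_morphism (@fps_deriv R).
Proof. by split=> [|a b]; apply/fpsP => n /=; rewrite ?mul0rn ?mulrnDl. Qed.
HB.instance Definition _ :=
  GRing.isNmodMorphism.Build (fps R) (fps R) (@fps_deriv R) fps_deriv_is_nmod.

Lemma fps_derivD a b : fps_deriv (a + b) = fps_deriv a + fps_deriv b.
Proof. exact: raddfD. Qed.

Lemma fps_trunc_coef n a i : (fps_trunc n a)`_i = if (i < n)%N then a i else 0.
Proof. exact: coef_poly. Qed.

Lemma fps_derivM a b : fps_deriv (a * b) = fps_deriv a * b + a * fps_deriv b.
Proof.
apply/fpsP => n.
rewrite -[RHS]/((fps_deriv a * b) n + (a * fps_deriv b) n).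
rewrite -[LHS]/((a * b) n.+1 *+ n.+1).
rewrite -[(a * b) _]/(fps_mul a b _) (@fps_mul_trunc _ n.+2) //.
rewrite -coef_deriv derivM coefD !coefM; congr (_ + _).
  apply: eq_bigr => i _; rewrite coef_deriv !fps_trunc_coef.
  have -> : (i.+1 < n.+2)%N by rewrite ltnS.
  by have -> : (n - i < n.+2)%N by lia.
apply: eq_bigr => i _; rewrite coef_deriv !fps_trunc_coef.
have -> : (i < n.+2)%N by have := ltn_ord i; lia.
by have -> : ((n - i).+1 < n.+2)%N by lia.
Qed.

Lemma fps_derivC c : fps_deriv (fpsC c : fps R) = 0.
Proof. by apply/fpsP => n /=; rewrite mul0rn. Qed.

Lemma fps_derivX : fps_deriv (fpsX : fps R) = 1.
Proof. by apply/fpsP => -[|n] /=; rewrite ?mul0rn. Qed.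

End Derivation.

(** Substitution of a series [y] without constant term for the variable,
    the coefficients being mapped by a ring morphism [s].  Instances: the
    composition of series in one variable, and (twice) the restriction of a
    series in two variables to an arc. *)
Section Substitution.
Variables (S R : comNzRingType) (s : {rmorphism S -> fps R}) (y : fps R).

Definition fps_subst (y0 : y 0%N = 0) (a : fps S) : fps R :=
  Fps (fun n => \sum_(j < n.+1) (s (a j) * y ^+ j) n).

Hypothesis y0 : y 0%N = 0.

(** Since [y ^+ j] vanishes to order [j], a coefficient of the result only
    sees finitely many coefficients of [a]; so [a] may be replaced by a
    polynomial, for which substitution is Horner evaluation. *)
Lemma fps_subst_poly (p : {poly S}) (a : fps S) n :
  (forall j, (j <= n)%N -> p`_j = a j) ->
  fps_subst y0 a n = (map_poly s p).[y] n.
Proof.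
move=> pa; pose N := maxn n.+1 (size p).
rewrite (@horner_coef_wide _ N); last first.
  by rewrite (leq_trans (size_poly _ _)) // leq_maxr.
rewrite fps_coef_sum -(big_mkord predT (fun j => ((map_poly s p)`_j * y ^+ j) n)).
rewrite (big_cat_nat (n := n.+1)) ?leq_maxl //= [X in _ + X]big_nat_cond.
rewrite [X in _ + X]big1 ?addr0 => [|j /andP[/andP[lt_nj _] _]]; last first.
  by apply: (@vanishesM _ 0 j (map_poly s p)`_j) lt_nj => //; apply: vanishes_exp.
rewrite big_mkord; apply: eq_bigr => j _.
by rewrite coef_map pa // -ltnS.
Qed.

Lemma fps_substE (a : fps S) n :
  fps_subst y0 a n = \sum_(j < n.+1) (s (a j) * y ^+ j) n.
Proof. by []. Qed.

Lemma fps_subst_is_nmod : nmod_morphism (fps_subst y0).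
Proof.
split=> [|a b]; apply/fpsP => n; rewrite ?fps_coefD !fps_substE.
  by rewrite big1 // => j _; rewrite rmorph0 mul0r.
by rewrite -big_split; apply: eq_bigr => j _; rewrite fps_coefD rmorphD mulrDl.
Qed.

Lemma fps_subst_is_monoid : monoid_morphism (fps_subst y0).
Proof.
split=> [|a b]; apply/fpsP => n.
  rewrite (@fps_subst_poly 1) ?rmorph1 ?hornerE // => j _.
  by rewrite coef1; case: j.
pose p c := fps_trunc n.+1 (c : fps S).
rewrite (@fps_subst_poly (p a * p b)); last first.
  by move=> j le_jn; rewrite -fps_mul_trunc.
rewrite rmorphM hornerM !fps_coefM; apply: eq_bigr => i _.
have pE k c j : (k < n.+1)%N -> (j <= k)%N -> (p c)`_j = c j.
  by move=> lt_kn le_jk; rewrite fps_trunc_coef (leq_ltn_trans le_jk).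
have := ltn_ord i => lt_in; congr (_ * _); apply/esym/fps_subst_poly => j.
  exact: (pE i).
by apply: (pE (n - i)%N); lia.
Qed.

HB.instance Definition _ := GRing.isNmodMorphism.Build (fps S) (fps R)
  (fps_subst y0) fps_subst_is_nmod.
HB.instance Definition _ := GRing.isMonoidMorphism.Build (fps S) (fps R)
  (fps_subst y0) fps_subst_is_monoid.

Lemma fps_substC c : fps_subst y0 (fpsC c) = s c.
Proof.
apply/fpsP => n; rewrite fps_substE big_ord_recl expr0 mulr1 big1 ?addr0 // => j _.
by rewrite rmorph0 mul0r.
Qed.

Lemma fps_substX : fps_subst y0 fpsX = y.
Proof.
apply/fpsP => n; rewrite (@fps_subst_poly 'X) => [|j _]; last by rewrite coefX.
by rewrite map_polyX hornerX.
Qed.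

Lemma fps_subst0 a : (fps_subst y0 a) 0%N = s (a 0%N) 0%N.
Proof. by rewrite fps_substE big_ord1 mulr1. Qed.

End Substitution.

(** * Weierstrass division *)

Section Division.
Variables (S : comNzRingType) (p : fps S) (rem : S -> Prop).

(** Division with remainder by the constant coefficient of [p], applied to
    the coefficients one after the other, is division with remainder by [p]. *)
Lemma fps_division :
  (forall w, exists q r, w = q * p 0%N + r /\ rem r) ->
  forall g : fps S, exists q r, g = q * p + r /\ forall n, rem (r n).
Proof.
move=> divp0.
have [d dP] : {d : S -> S * S &
    forall w, w = (d w).1 * p 0%N + (d w).2 /\ rem (d w).2}.
  apply: (@choice _ _ (fun w d => w = d.1 * p 0%N + d.2 /\ rem d.2)) => w.
  by have [q [r wE]] := divp0 w; exists (q, r).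
(* [g = q0 p + r0 + X g'], where [g'] is divided in the same way *)
pose step (g : fps S) := fps_drop 1 (g - fpsC (d (g 0%N)).1 * p).
pose Q g := Fps (fun k => (d (iter k step g 0%N)).1).
pose D g := Fps (fun k => (d (iter k step g 0%N)).2).
have QE (g : fps S) : Q g = fpsC (d (g 0%N)).1 + fpsX * Q (step g).
  rewrite [LHS]fps_split; congr (_ + fpsX * _).
  by apply/fpsP => k; rewrite -[LHS]/((d (iter k.+1 step g 0%N)).1) iterSr.
have DE (g : fps S) : D g = fpsC (d (g 0%N)).2 + fpsX * D (step g).
  rewrite [LHS]fps_split; congr (_ + fpsX * _).
  by apply/fpsP => k; rewrite -[LHS]/((d (iter k.+1 step g 0%N)).2) iterSr.
have gE (g : fps S) : g = fpsC (d (g 0%N)).1 * p + fpsC (d (g 0%N)).2 + fpsX * step g.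
  set h := g - fpsC (d (g 0%N)).1 * p.
  have -> : fpsC (d (g 0%N)).2 = fpsC (h 0%N).
    by rewrite fps_coefB fpsC_coefM {2}(dP (g 0%N)).1 addrC addKr.
  by rewrite -addrA -(fps_split h) addrC subrK.
move=> g; exists (Q g), (D g); split; last by move=> n; case: (dP (iter n step g 0%N)).
apply/eqP; rewrite -subr_eq0; apply/eqP; move: g.
apply: (@contracting_family _ _ _ fpsX) => // g; exists (step g).
by rewrite {1}(gE g) QE DE; ring.
Qed.

End Division.

Lemma fps_unit0 (R : comUnitRingType) (a : fps R) :
  a 0%N \is a GRing.unit -> a \is a GRing.unit.
Proof.
move=> a0U; have [|q [r [qa r0]]] := @fps_division _ a (eq^~ 0) _ 1.
  by move=> w; exists (w / a 0%N), 0; rewrite divrK ?addr0.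
apply/unitrPr; exists q; rewrite mulrC qa.
by have -> : r = 0; [apply/fpsP => n; rewrite r0 | rewrite addr0].
Qed.

Section FieldSeries.
Variable K : fieldType.
Implicit Types a b u : fps K.

Lemma has_order_dvd a b n :
  has_order a n -> vanishes n b -> exists c, b = c * a.
Proof.
move=> [an va] vb; have aE := vanishesE va.
have uU : fps_drop n a \is a GRing.unit.
  by apply: fps_unit0; rewrite unitfE /= addn0.
exists (fps_drop n b / fps_drop n a); move: {an va} (fps_drop n a) uU aE => v vU ->.
by rewrite mulrCA divrK // -vanishesE.
Qed.

(** If [p] does not vanish on the axis carrying its constant coefficient
    [p 0], every series is, modulo [p], polynomial of bounded degree in the
    coordinate of that axis. *)
Lemma weierstrass_division (p : fps2 K) s : has_order (p 0%N) s ->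
  forall g, exists q r : fps2 K,
    g = q * p + r /\ forall n k, (s <= k)%N -> r n k = 0.
Proof.
move=> ps g; pose low (r : fps K) := forall k, (s <= k)%N -> r k = 0.
have [w|q [r [-> rP]]] := @fps_division _ p low _ g; last by exists q, r.
pose r : fps K := Fps (fun k => if (k < s)%N then w k else 0).
have [|q qE] := @has_order_dvd _ (w - r) _ ps.
  by move=> k lt_ks; rewrite fps_coefB /= lt_ks subrr.
exists q, r; rewrite -qE subrK; split=> // k le_sk.
by rewrite /= ltnNge le_sk.
Qed.

End FieldSeries.

Section Composition.
Variable R : comNzRingType.
Implicit Types a u t : fps R.

Lemma fps_compE a t (t0 : t 0%N = 0) : fps_comp a t = fps_subst (@fpsC R) t0 a.
Proof.
by apply/fpsP => n; apply: eq_bigr => i _; rewrite fpsC_coefM.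
Qed.

(** A class [B] of series stable under expansion to first order in [t]
    consists of series in [t]. *)
Lemma fps_comp_expansion t (B : fps R -> Prop) : t 0%N = 0 ->
  (forall u, B u -> exists v, B v /\ u = fpsC (u 0%N) + t * v) ->
  forall u, B u -> exists c, u = fps_comp c t.
Proof.
move=> t0 expand.
have [next nextP] : {next : fps R -> fps R &
    forall u, B u -> B (next u) /\ u = fpsC (u 0%N) + t * next u}.
  apply: (@choice _ _ (fun u v => B u -> B v /\ u = fpsC (u 0%N) + t * v)) => u.
  case: (pselect (B u)) => [/expand[v]|]; first by exists v.
  by exists 0.
pose c u := Fps (fun k => iter k next u 0%N).
have cE (u : fps R) : c u = fpsC (u 0%N) + fpsX * c (next u).
  rewrite [LHS]fps_split; congr (_ + fpsX * _).
  by apply/fpsP => k; rewrite -[LHS]/(iter k.+1 next u 0%N) iterSr.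
pose E (w : {u | B u}) := sval w - fps_comp (c (sval w)) t.
have E0 w : E w = 0.
  apply: (@contracting_family _ _ E t) => // -[u Bu].
  have [Bv uE] := nextP u Bu; exists (exist _ (next u) Bv); rewrite /E /=.
  rewrite !(fps_compE _ t0) cE rmorphD rmorphM /= fps_substC fps_substX.
  by rewrite {1}uE; ring.
move=> u Bu; exists (c u); apply/eqP; rewrite -subr_eq0; apply/eqP.
exact: (E0 (exist _ u Bu)).
Qed.

End Composition.

(** * Series in two variables and arcs *)

Section Swap.
Variable K : fieldType.
Implicit Types (f g : fps2 K) (gamma : formal_arc K).

(** The two variables of an iterated series play different roles; results
    proved for one of them are transported to the other by this involution. *)
Definition swap f : fps2 K := Fps (fun i => Fps (fun j => f j i)).
Definition swap_arc gamma : formal_arc K := (gamma.2, gamma.1).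

Lemma swapK : involutive swap.
Proof. by move=> f; apply/fpsP => j; apply/fpsP. Qed.

Lemma swap_is_nmod : nmod_morphism swap.
Proof. by split=> [|f g]; apply/fpsP => j; apply/fpsP. Qed.

Lemma swap_is_monoid : monoid_morphism swap.
Proof.
split=> [|f g]; apply/fpsP => j; apply/fpsP => i; first by case: i j => [|i] [|j].
rewrite -[LHS]/((f * g) i j) !fps_coefM !fps_coef_sum.
under eq_bigr do rewrite fps_coefM.
by under [RHS]eq_bigr do rewrite fps_coefM; rewrite exchange_big.
Qed.

HB.instance Definition _ :=
  GRing.isNmodMorphism.Build (fps2 K) (fps2 K) swap swap_is_nmod.
HB.instance Definition _ :=
  GRing.isMonoidMorphism.Build (fps2 K) (fps2 K) swap swap_is_monoid.

Lemma swap_dx f : swap (dx f) = dy (swap f).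
Proof.
by apply/fpsP => j; apply/fpsP => i; rewrite /= fps_coefMn.
Qed.

Lemma swap_dy f : swap (dy f) = dx (swap f).
Proof. by rewrite -[dx _]swapK swap_dx swapK. Qed.

Lemma swap_irreducible f : irreducible_elt f -> irreducible_elt (swap f).
Proof.
have unit_swap g : (swap g \is a GRing.unit) = (g \is a GRing.unit).
  by apply/idP/idP => /(rmorph_unit swap); rewrite ?swapK.
case=> fU firr; split=> [|u v]; first by rewrite unit_swap.
move=> /(congr1 swap); rewrite swapK rmorphM /= => /firr.
by rewrite !unit_swap.
Qed.

Lemma pullback_swap f gamma :
  pullback (swap f) (swap_arc gamma) = pullback f gamma.
Proof.
apply/fpsP => n; rewrite [LHS]exchange_big; apply: eq_bigr => i _.
by apply: eq_bigr => j _; rewrite [gamma.1 ^+ _ * _]mulrC.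
Qed.

End Swap.

Section Arc.
Variable K : fieldType.
Implicit Types (f g : fps2 K) (gamma : formal_arc K).

Definition varX : fps2 K := fpsC fpsX.
Definition varY : fps2 K := fpsX.

Definition pull gamma (c : centered gamma) : {rmorphism fps2 K -> fps K} :=
  fps_subst (fps_subst (@fpsC K) c.1) c.2.

Lemma pullbackE gamma (c : centered gamma) f : pullback f gamma = pull c f.
Proof.
apply/fpsP => n; rewrite [RHS]fps_substE; apply: eq_bigr => j _.
rewrite [RHS]fps_coefM; under [RHS]eq_bigr => k _.
  rewrite (@fps_subst_poly _ _ _ _ _ (fps_trunc n.+1 (f j))); last first.
    move=> i le_ik; rewrite fps_trunc_coef ifT //.
    by have := ltn_ord k; lia.
  rewrite (@horner_coef_wide _ n.+1); last first.
    by rewrite (leq_trans (size_poly _ _)) // size_poly.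
  over.
rewrite -(@fps_coefM _ _ _ n) mulr_suml fps_coef_sum; apply: eq_bigr => i _.
by rewrite coef_map fps_trunc_coef ltn_ord -mulrA fpsC_coefM.
Qed.

Lemma pull_varX gamma (c : centered gamma) : pull c varX = gamma.1.
Proof. by rewrite [LHS]fps_substC [LHS]fps_substX. Qed.
Lemma pull_varY gamma (c : centered gamma) : pull c varY = gamma.2.
Proof. exact: fps_substX. Qed.
Lemma pullback_varX gamma : centered gamma -> pullback varX gamma = gamma.1.
Proof. by move=> c; rewrite (pullbackE c) pull_varX. Qed.
Lemma pullback_varY gamma : centered gamma -> pullback varY gamma = gamma.2.
Proof. by move=> c; rewrite (pullbackE c) pull_varY. Qed.
Lemma pull_const gamma (c : centered gamma) k : pull c (fpsC (fpsC k)) = fpsC k.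
Proof. by rewrite [LHS]fps_substC [LHS]fps_substC. Qed.
Lemma pull_comp gamma (c : centered gamma) a :
  pull c (fpsC a) = fps_comp a gamma.1.
Proof. by rewrite [LHS]fps_substC (fps_compE _ c.1). Qed.
Lemma pull_coef0 gamma (c : centered gamma) f : pull c f 0%N = value0 f.
Proof. by rewrite [LHS]fps_subst0 [LHS]fps_subst0. Qed.

End Arc.

Global Opaque pull.

(** * The branch as a subring of the series ring of its parameter *)

Lemma irreducible_neq0 (A : comUnitRingType) (f : A) : irreducible_elt f -> f != 0.
Proof.
case=> _ firr; apply/eqP => f0; have := firr 0 0.
by rewrite f0 mulr0 unitr0 => /(_ erefl)[].
Qed.

Lemma irreducible_coprime (A : comUnitRingType) (f g : A) : irreducible_elt f ->
  relatively_prime g f <-> ~ exists u, g = u * f.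
Proof.
case=> fU firr; split=> [gf [u gE]|ngf d u v gE fE].
  by case/negP: fU; apply: (gf f u 1); rewrite ?mulr1 // mulrC.
case: (firr d v fE) => // vU; case: ngf; exists (v^-1 * u).
by rewrite gE fE [d * v]mulrC mulrACA mulVr // mul1r mulrC.
Qed.

Section Kernel.
Variable K : fieldType.
Implicit Types (f g p : fps2 K) (gamma : formal_arc K).

Lemma pull_unit gamma (c : centered gamma) g :
  g \is a GRing.unit -> pull c g != 0.
Proof. by move=> /(rmorph_unit (pull c)); apply: contraTneq => ->; rewrite unitr0. Qed.

(** Among the series vanishing on the arc and not divisible by [y], one of
    minimal order along [y = 0] divides all series vanishing on the arc: the
    remainder of a division by it would, divided by a power of [y], have a
    smaller order. *)
Lemma pull_kernel_y gamma (c : centered gamma) f :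
  irreducible_elt f -> gamma.2 != 0 -> pull c f = 0 ->
  forall g, pull c g = 0 -> exists u, g = u * f.
Proof.
move=> firr y_neq0 f0.
have reduce g : pull c g = 0 -> g != 0 ->
    exists k p, [/\ pull c p = 0, p 0%N = g k & g k != 0].
  move=> g0 /has_order_exists[k [gk vg]]; exists k, (fps_drop k g).
  rewrite /= addn0; split=> //; move: g0; rewrite {1}(vanishesE vg).
  rewrite rmorphM rmorphXn /= pull_varY => /eqP.
  by rewrite mulf_eq0 expf_eq0 (negPf y_neq0) andbF => /eqP.
pose P s := `[< exists p, pull c p = 0 /\ has_order (p 0%N) s >].
have exP : exists s, P s.
  have [k [p [p0 pk fk]]] := reduce f f0 (irreducible_neq0 firr).
  have [s fs] := has_order_exists fk.
  by exists s; apply/asboolP; exists p; rewrite pk.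
have [s /asboolP[p [p0 ps]] s_min] := ex_minnP exP.
have pdvd g : pull c g = 0 -> exists u, g = u * p.
  have [q [r [gE r_low]]] := weierstrass_division ps g.
  rewrite gE rmorphD rmorphM p0 mulr0 add0r => r0; exists q.
  have [->|r_neq0] := eqVneq r 0; first by rewrite addr0.
  have [k [t [t0 tk rk]]] := reduce r r0 r_neq0.
  have [m [rm vr]] := has_order_exists rk.
  have : (s <= m)%N by apply/s_min/asboolP; exists t; rewrite tk.
  by move=> /(r_low k m) rkm; rewrite rkm eqxx in rm.
have [q fE] := pdvd f f0; have [_ /(_ _ _ fE)[qU|pU]] := firr.
  move=> g /pdvd[u ->]; exists (u / q).
  by rewrite fE mulrA divrK.
by have := pull_unit c pU; rewrite p0 eqxx.
Qed.

Lemma centered_swap gamma : centered gamma -> centered (swap_arc gamma).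
Proof. by case. Qed.

Lemma pull_swap gamma (c : centered gamma) g :
  pull (centered_swap c) (swap g) = pull c g.
Proof. by rewrite -!pullbackE pullback_swap. Qed.

Lemma pull_kernel gamma (c : centered gamma) f :
  irreducible_elt f -> gamma != (0, 0) -> pull c f = 0 ->
  forall g, pull c g = 0 -> exists u, g = u * f.
Proof.
move=> firr gamma_neq0 f0 g g0.
have [y0|] := eqVneq gamma.2 0; last by move/pull_kernel_y; apply.
have x_neq0 : gamma.1 != 0.
  by apply: contraNneq gamma_neq0 => x0; rewrite [gamma]surjective_pairing x0 y0.
have sf0 : pull (centered_swap c) (swap f) = 0 by rewrite pull_swap.
have sg0 : pull (centered_swap c) (swap g) = 0 by rewrite pull_swap.
have [u /(congr1 (@swap K))] :=
  pull_kernel_y (swap_irreducible firr) (x_neq0 : (swap_arc gamma).2 != 0) sf0 sg0.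
by rewrite rmorphM /= !swapK => ->; exists (swap u).
Qed.

(** Multiplicative form of the finite codimension of the ring of the branch in
    the ring of all series in the parameter. *)
Definition has_conductor gamma (c : centered gamma) :=
  exists2 b : fps K, b != 0 & forall u, exists g, b * u = pull c g.

(** The series that are quotients of restrictions to the arc form a discrete
    valuation ring.  An element [t] of minimal positive order is a uniformizer,
    so all elements of the ring are series in [t], the two coordinates of the
    arc in particular; primitivity then forces [t] to have order one. *)
Lemma primitive_uniformizer gamma (c : centered gamma) :
  gamma != (0, 0) ->
  (forall (delta : formal_arc K) (tau : fps K), centered delta -> tau 0%N = 0 ->
     gamma = (fps_comp delta.1 tau, fps_comp delta.2 tau) -> fps_ord tau = 1%E) ->
  exists t n0 n1, [/\ has_order t 1, pull c n1 != 0 & t * pull c n1 = pull c n0].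
Proof.
move=> gamma_neq0 prim.
pose B (u : fps K) := exists n0 n1, pull c n1 != 0 /\ u * pull c n1 = pull c n0.
have B_pull g : B (pull c g).
  by exists g, 1; rewrite rmorph1 mulr1 oner_neq0.
pose P d := `[< exists u, [/\ B u, has_order u d & u 0%N = 0] >].
have exP : exists d, P d.
  have [g g_neq0 g0] : exists2 g, pull c g != 0 & pull c g 0%N = 0.
    have [y0|y_neq0] := eqVneq gamma.2 0.
      exists (varX K); rewrite pull_varX ?c.1 //; apply: contraNneq gamma_neq0 => x0.
      by rewrite [gamma]surjective_pairing x0 y0.
    by exists (varY K); rewrite pull_varY ?c.2.
  by have [d gd] := has_order_exists g_neq0; exists d; apply/asboolP; exists (pull c g).
have [d /asboolP[t [[n0 [n1 [n1_neq0 tE]]] td t0]] d_min] := ex_minnP exP.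
suff d1 : d = 1%N by exists t, n0, n1; rewrite -d1.
have t_neq0 := has_order_neq0 td.
have n0_neq0 : pull c n0 != 0 by rewrite -tE mulf_neq0.
have expand u : B u -> exists v, B v /\ u = fpsC (u 0%N) + t * v.
  move=> [m0 [m1 [m1_neq0 uE]]]; pose w := u - fpsC (u 0%N).
  have wE : w * pull c m1 = pull c (m0 - fpsC (fpsC (u 0%N)) * m1).
    by rewrite rmorphB rmorphM /= pull_const -uE mulrBl.
  have vw : vanishes d w.
    have [->|/has_order_exists[k wk]] := eqVneq w 0; first by [].
    apply: (@vanishesW _ _ k); last by case: wk.
    apply/d_min/asboolP; exists w; split=> //; last by rewrite fps_coefB subrr.
    by exists (m0 - fpsC (fpsC (u 0%N)) * m1), m1.
  have [v vE] := has_order_dvd td vw.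
  exists v; split; last by rewrite mulrC -vE /w addrC subrK.
  exists ((m0 - fpsC (fpsC (u 0%N)) * m1) * n1), (n0 * m1).
  rewrite !rmorphM /= mulf_neq0 //; split=> //.
  by rewrite -tE -[in RHS]wE vE; ring.
have comp u : B u -> u 0%N = 0 -> exists2 a : fps K, a 0%N = 0 & u = fps_comp a t.
  move=> Bu u0; have [a uE] := fps_comp_expansion t0 expand Bu; exists a => //.
  by move: u0; rewrite uE (fps_compE _ t0) fps_subst0.
have [||a a0 xE] := comp gamma.1; [|exact: c.1|].
  by rewrite -(pull_varX c).
have [||b b0 yE] := comp gamma.2; [|exact: c.2|].
  by rewrite -(pull_varY c).
have /has_orderP t1 : fps_ord t = 1%N%:Z%:E.
  apply: (prim (a, b)) => //.
  by rewrite /= -xE -yE -surjective_pairing.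
exact: has_order_uniq td t1.
Qed.

(** With [t n1 = n0] and a coordinate [z = e(t)], a division by [e(Y) - X]
    writes every series as a combination of powers of [t] below some bound
    [s], with coefficients that are series in [z]; multiplication by [n1^s]
    then takes it into the ring of the branch. *)
Lemma conductor_x gamma (c : centered gamma) t n0 n1 :
  has_order t 1 -> pull c n1 != 0 -> t * pull c n1 = pull c n0 ->
  gamma.1 != 0 -> has_conductor c.
Proof.
move=> t1 n1_neq0 tE x_neq0; have t0 : t 0%N = 0 by apply: t1.2.
have comp (u : fps K) : exists a, u = fps_comp a t.
  apply: (@fps_comp_expansion _ _ (fun _ => True)) => // {}u _.
  have [|v vE] := @has_order_dvd _ _ (u - fpsC (u 0%N)) _ t1.
    by case=> // _; rewrite fps_coefB subrr.
  by exists v; split=> //; rewrite mulrC -vE addrC subrK.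
have [e xE] := comp gamma.1.
have [s es] : exists s, has_order e s.
  apply: has_order_exists; apply: contraNneq x_neq0 => e0.
  by rewrite xE e0 (fps_compE _ t0) rmorph0.
pose delta : formal_arc K := (t, gamma.1).
have cdelta : centered delta by split=> //; exact: c.1.
(* in [p], the first variable stands for [t] and the second for the coordinate *)
pose p : fps2 K := fpsC e - varY K.
have ps : has_order (p 0%N) s by rewrite /p fps_coefB subr0.
have p0 : pull cdelta p = 0.
  by rewrite rmorphB pull_comp pull_varY -xE subrr.
exists (pull c n1 ^+ s); first by rewrite expf_neq0.
move=> u; have [a uE] := comp u.
have [q [r [aE r_low]]] := weierstrass_division ps (fpsC a).
have {uE aE}uE : u = pull cdelta r.
  have aD : pull cdelta (fpsC a) = fps_comp a t by apply: pull_comp.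
  by rewrite uE -aD aE rmorphD rmorphM p0 mulr0 add0r.
pose col i : fps K := Fps (fun n => r n i).
have rE : r = \sum_(i < s) swap (fpsC (col i)) * varX K ^+ i.
  apply/fpsP => n; apply/fpsP => k; rewrite !fps_coef_sum.
  have termE i : (swap (fpsC (col i)) * varX K ^+ i) n k = r n i *+ (k == i).
    have -> : varX K ^+ i = fpsC (fpsX ^+ i) by rewrite rmorphXn.
    rewrite mulrC fpsC_coefM fpsXn_coefM.
    have [lt_ki|le_ik] := ltnP k i; first by rewrite ltn_eqF.
    by rewrite eqn_leq le_ik andbT -subn_eq0; case: (k - i)%N.
  under eq_bigr do rewrite termE.
  have [lt_ks|le_sk] := ltnP k s.
    rewrite (bigD1 (Ordinal lt_ks)) //= eqxx big1 ?addr0 // => i /eqP nki.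
    by case: eqP => // ki; case: nki; apply: val_inj.
  rewrite r_low // big1 // => i _.
  by rewrite gtn_eqF // (leq_trans (ltn_ord i)).
exists (\sum_(i < s) fpsC (col i) * (n0 ^+ i * n1 ^+ (s - i))).
rewrite uE rE !rmorph_sum mulr_sumr; apply: eq_bigr => i _.
have colE : pull cdelta (swap (fpsC (col i))) = pull c (fpsC (col i)).
  by rewrite -(pull_swap cdelta) swapK !pull_comp.
have tiE : pull c n1 ^+ s * t ^+ i = pull c (n0 ^+ i * n1 ^+ (s - i)).
  have -> : pull c n1 ^+ s = pull c n1 ^+ i * pull c n1 ^+ (s - i).
    by rewrite -exprD (subnKC (ltnW (ltn_ord i))).
  by rewrite rmorphM !rmorphXn /= -tE exprMn mulrAC [t ^+ i * _]mulrC.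
have tX : pull cdelta (varX K) = t by apply: pull_varX.
by rewrite (rmorphM (pull cdelta)) (rmorphXn (pull cdelta)) colE tX rmorphM -tiE mulrCA.
Qed.

Lemma primitive_conductor gamma (c : centered gamma) f :
  primitive_parametrization f gamma -> has_conductor c.
Proof.
case=> _ gamma_neq0 _ /(primitive_uniformizer c gamma_neq0).
move=> [t [n0 [n1 [t1 n1_neq0 tE]]]].
have [x0|] := eqVneq gamma.1 0; last exact: conductor_x t1 n1_neq0 tE.
have y_neq0 : gamma.2 != 0.
  by apply: contraNneq gamma_neq0 => y0; rewrite [gamma]surjective_pairing x0 y0.
have sn1_neq0 : pull (centered_swap c) (swap n1) != 0 by rewrite pull_swap.
have stE : t * pull (centered_swap c) (swap n1) = pull (centered_swap c) (swap n0).
  by rewrite (pull_swap c n0) (pull_swap c n1).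
have [b b_neq0 bP] := conductor_x t1 sn1_neq0 stE y_neq0.
exists b; first exact: b_neq0.
move=> u; have [g bu] := bP u; exists (swap g).
by rewrite bu -(pull_swap c (swap g)) swapK.
Qed.

End Kernel.

(** * Intersection numbers as orders along a primitive arc *)

(** A matrix of maximal rank among those whose row space lies in [P]. *)
Lemma linear_set_mx (K : fieldType) n (P : 'rV[K]_n -> Prop) :
  P 0 -> (forall k v w, P v -> P w -> P (k *: v + w)) ->
  exists A : 'M[K]_n, forall v, (v <= A)%MS <-> P v.
Proof.
move=> P0 Plin.
pose Q r := `[< exists A : 'M[K]_n, \rank A = r /\ forall v, (v <= A)%MS -> P v >].
have exQ : exists r, Q r.
  exists 0%N; apply/asboolP; exists 0; rewrite mxrank0; split=> // v.
  by rewrite submx0 => /eqP->.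
have Qn r : Q r -> (r <= n)%N by move=> /asboolP[A [<- _]]; apply: rank_leq_row.
case: (ex_maxnP exQ Qn) => r /asboolP[A [rA AP]] r_max; exists A => v.
split=> [/AP //|Pv]; have lt_A : (A <= A + v)%MS by apply: addsmxSl.
have : (\rank (A + v)%MS <= \rank A)%N.
  rewrite rA; apply/r_max/asboolP; exists (A + v)%MS; split=> // w.
  case/sub_addsmxP => -[x y] /= ->; rewrite addrC [y]mx11_scalar mul_scalar_mx.
  by apply: Plin => //; apply: AP; apply: submxMl.
rewrite (geq_leqif (mxrank_leqif_sup lt_A)).
exact: submx_trans (addsmxSr A v).
Qed.

(** Intersection numbers become ranks: a basis of the quotient is a family
    mapped to a basis of the image of [L]. *)
Lemma intersection_number_rank (K : fieldType) (f h : fps2 K) k m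
    (L : fps2 K -> 'rV[K]_k) (M : 'M[K]_(m, k)) :
  {morph L : a b / a + b} ->
  (forall c a, L (fpsC (fpsC c) * a) = c *: L a) ->
  (forall a, L a = 0 <-> exists u v, a = u * f + v * h) ->
  (forall v, (v <= M)%MS <-> exists a, L a = v) ->
  intersection_number f h = (\rank M)%:Z%:E.
Proof.
move=> LD LZ Lker Lim.
have L0 : L 0 = 0 by apply/Lker; exists 0, 0; rewrite !mul0r addr0.
have LB a b : L (a - b) = L a - L b.
  by apply/eqP; rewrite eq_sym subr_eq -LD subrK.
pose E n (e : 'I_n -> fps2 K) := \matrix_i L (e i).
have Lsum n (e : 'I_n -> fps2 K) (c : 'rV_n) :
    L (\sum_(i < n) fpsC (fpsC (c 0 i)) * e i) = c *m E n e.
  rewrite (big_morph L LD L0) mulmx_sum_row; apply: eq_bigr => i _.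
  by rewrite LZ rowK.
have basisE n e : @quotient_basis K f h n e <->
    forall a, exists! c, L a = c *m E n e.
  have eqv a (c : 'rV_n) : (exists u v,
      a = \sum_(i < n) fpsC (fpsC (c 0 i)) * e i + (u * f + v * h)) <->
      L a = c *m E n e.
    rewrite -Lsum; split=> [[u [v ->]]|/eqP].
      rewrite LD; have -> : L (u * f + v * h) = 0 by apply/Lker; exists u, v.
      by rewrite addr0.
    rewrite -subr_eq0 -LB => /eqP/Lker[u [v /eqP]].
    by rewrite subr_eq addrC => /eqP ->; exists u, v.
  split=> ba a; have [c [/eqv ca c_uniq]] := ba a; exists c; split=> // d /eqv.
    exact: c_uniq.
  exact: c_uniq.
rewrite /intersection_number; case: xgetP => [_ -> [n [e [-> /basisE ba]]]|].
  congr (_%:Z%:E).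
  have EM : (E n e :=: M)%MS.
    apply/eqmxP/andP; split; apply/row_subP => i.
      by rewrite rowK; apply/Lim; exists (e i).
    have /Lim[a <-] : (row i M <= M)%MS by apply: row_sub.
    by have [c [-> _]] := ba a; apply: submxMl.
  rewrite -EM; apply/esym/eqP; apply: inj_row_free => c c0.
  have [d [_ d_uniq]] := ba 0.
  by rewrite -(d_uniq c) ?L0 // -(d_uniq 0) ?L0 // mul0mx.
have exe i : exists a, L a = row i (row_base M).
  by apply/Lim; rewrite -(eq_row_base M); apply: row_sub.
have [e eP] := choice exe; move=> /(_ (\rank M)%:Z%:E); case.
exists (\rank M), e; split=> //; apply/basisE => a.
have -> : E _ e = row_base M by apply/row_matrixP => i; rewrite rowK eP.
have /submxP[c cE] : (L a <= row_base M)%MS.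
  by rewrite eq_row_base; apply/Lim; exists a.
exists c; split=> // d; rewrite cE.
exact: (row_free_inj (row_base_free M)).
Qed.

Section Intersection.
Variable K : fieldType.
Implicit Types (a b u : fps K).

Definition truncation n a : 'rV[K]_n := \row_i a i.

Lemma truncation_lin n k a b :
  truncation n (fpsC k * a + b) = k *: truncation n a + truncation n b.
Proof. by apply/rowP => i; rewrite !mxE fps_coefD fpsC_coefM. Qed.

Lemma truncation_eq0 n a : truncation n a = 0 <-> vanishes n a.
Proof.
split=> [/rowP a0 i lt_in|va]; last by apply/rowP => i; rewrite !mxE va.
by have := a0 (Ordinal lt_in); rewrite !mxE.
Qed.

Lemma truncation_onto n v : exists a, truncation n a = v.
Proof.
exists (Fps (fun i => if insub i is Some j then v 0 j else 0)).
by apply/rowP => i; rewrite !mxE /= valK.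
Qed.

Lemma truncation_cat n m a :
  truncation (n + m) a = row_mx (truncation n a) (truncation m (fps_drop n a)).
Proof.
by apply/rowP => i; rewrite !mxE; case: splitP => j /= ->; rewrite mxE.
Qed.

(** Matrix of the multiplication by [b] on truncated series.  For [b] of order
    [m] it is defined from precision [n] to precision [n + m]. *)
Definition shift_mulmx n m b : 'M[K]_(n, n + m) :=
  \matrix_(i, j) if (i <= j)%N then b (j - i)%N else 0.

Lemma shift_mulmxE n m a b : vanishes m b ->
  truncation (n + m) (b * a) = truncation n a *m shift_mulmx n m b.
Proof.
move=> vb; apply/rowP => j; rewrite !mxE mulrC fps_coefM.
under [RHS]eq_bigr do rewrite !mxE.
pose F i := a i * (if (i <= j)%N then b (j - i)%N else 0).
rewrite -(big_mkord predT (fun i => a i * b (j - i)%N)).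
rewrite -(big_mkord predT F); pose N := (j.+1 + n)%N.
transitivity (\sum_(0 <= i < N) F i).
  rewrite [RHS](big_cat_nat (n := j.+1)) ?leq_addr //=.
  rewrite [X in _ + X]big_nat_cond [X in _ + X]big1 ?addr0; last first.
    by move=> i /andP[/andP[lt_ji _] _]; rewrite /F leqNgt lt_ji mulr0.
  by apply: eq_big_nat => i /andP[_ lt_ij]; rewrite /F -ltnS lt_ij.
rewrite [LHS](big_cat_nat (n := n)) ?leq_addl //=.
rewrite [X in _ + X]big_nat_cond [X in _ + X]big1 ?addr0 // => i.
move=> /andP[/andP[le_ni _] _]; rewrite /F; case: leqP => [le_ij|]; last by rewrite mulr0.
by rewrite vb ?mulr0 //; have := ltn_ord j; lia.
Qed.

Lemma shift_mulmx_free n m b : has_order b m -> row_free (shift_mulmx n m b).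
Proof.
move=> [bm vb]; apply: inj_row_free => v; have [a <-] := truncation_onto v.
rewrite -shift_mulmxE // => /truncation_eq0 vba; apply/truncation_eq0.
have [->|/has_order_exists[k ak]] := eqVneq a 0; first by [].
have := vanishes_order (has_orderM (conj bm vb) ak) vba.
by rewrite addnC leq_add2l => le_nk; apply: vanishesW le_nk ak.2.
Qed.

(** Let [A] be the ring of the branch [f = 0], a subring of finite codimension
    of the series ring of the parameter, and [b] the restriction of [h].
    Multiplication by [b] maps [A] modulo order [N] bijectively onto [b A]
    modulo order [N + m], whereas [A] contains all series of order [N]; so
    [A / b A] has the dimension [m] of the series modulo [b]. *)
Lemma intersection_number_order gamma (c : centered gamma) (f h : fps2 K) m :
  irreducible_elt f -> primitive_parametrization f gamma ->
  has_order (pull c h) m -> intersection_number f h = m%:Z%:E.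
Proof.
move=> firr prim hm; have [_ gamma_neq0 f0 _] := prim.
rewrite (pullbackE c) in f0.
have ker := pull_kernel firr gamma_neq0 f0.
have [b b_neq0 bP] := primitive_conductor c prim.
have [N bN] := has_order_exists b_neq0.
have high u : vanishes N u -> exists g, pull c g = u.
  move=> /(has_order_dvd bN)[v ->]; have [g gE] := bP v.
  by exists g; rewrite -gE mulrC.
set hh := pull c h in hm *; have [_ vh] := hm.
have pull_lin k g g' : pull c (fpsC (fpsC k) * g + g') = fpsC k * pull c g + pull c g'.
  by rewrite [LHS]rmorphD rmorphM pull_const.
have [||A AP] := @linear_set_mx K N (fun v => exists g, truncation N (pull c g) = v).
- by exists 0; rewrite rmorph0; apply/truncation_eq0.
- move=> k _ _ [g <-] [g' <-]; exists (fpsC (fpsC k) * g + g').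
  by rewrite pull_lin truncation_lin.
pose W := A *m shift_mulmx N m hh.
pose U : 'M_(N + m) := block_mx A 0 0 1%:M.
have WP v : (v <= W)%MS <-> exists g, truncation (N + m) (hh * pull c g) = v.
  split=> [/submxP[x ->]|[g <-]].
    have /AP[g gE] : (x *m A <= A)%MS by apply: submxMl.
    by exists g; rewrite shift_mulmxE // gE mulmxA.
  by rewrite shift_mulmxE // submxMr //; apply/AP; exists g.
have UP v : (v <= U)%MS <-> exists g, truncation (N + m) (pull c g) = v.
  split=> [/submxP[x ->]|[g <-]].
    rewrite -[x]hsubmxK mul_row_block !mulmx0 add0r addr0 mulmx1.
    have /AP[g gE] : (lsubmx x *m A <= A)%MS by apply: submxMl.
    have [w wE] := truncation_onto (rsubmx x - truncation m (fps_drop N (pull c g))).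
    have [g' g'E] := high _ (@vanishesXn _ N w).
    exists (g + g'); rewrite truncation_cat rmorphD g'E; congr row_mx.
      rewrite -gE; apply/rowP => i; rewrite !mxE fps_coefD vanishesXn ?addr0 //.
    apply/rowP => i; have /rowP/(_ i) := wE; rewrite !mxE => wi.
    rewrite -[LHS]/((pull c g + fpsX ^+ N * w) (N + i)%N) fps_coefD.
    by rewrite fpsXn_coefM ltnNge leq_addr /= addKn wi [LHS]addrC subrK.
  have /submxP[x xE] : (truncation N (pull c g) <= A)%MS by apply/AP; exists g.
  rewrite truncation_cat xE.
  set y := truncation m _; have -> : row_mx (x *m A) y = row_mx x y *m U.
    by rewrite mul_row_block !mulmx0 add0r addr0 mulmx1.
  exact: submxMl.
have WU : (W <= U)%MS.
  apply/row_subP => i; have /WP[g <-] : (row i W <= W)%MS by apply: row_sub.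
  by apply/UP; exists (h * g); rewrite rmorphM.
have rW : \rank W = \rank A by apply/mxrankMfree/shift_mulmx_free.
have rU : \rank U = (\rank A + m)%N by rewrite rank_diag_block_mx mxrank1.
pose C := cokermx W.
have rM : \rank (U *m C) = m.
  have capE : (U :&: kermx C :=: W)%MS.
    apply/eqmxP/andP; split; last by rewrite sub_capmx WU; apply/sub_kermxP/mulmx_coker.
    apply: submx_trans (capmxSr _ _) _.
    by rewrite submxE; apply/eqP/mulmx_ker.
  by have := mxrank_mul_ker U C; rewrite capE rW rU addnC => /addnI.
pose L g := truncation (N + m) (pull c g) *m C.
rewrite -[X in X%:Z]rM; apply: (@intersection_number_rank _ _ _ _ _ L).
- move=> g g'; rewrite /L -mulmxDl rmorphD; congr (_ *m _).
  by apply/rowP => i; rewrite !mxE.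
- move=> k g; rewrite /L -[_ * g]addr0 pull_lin truncation_lin rmorph0.
  have -> : truncation (N + m) 0 = 0 by apply/truncation_eq0.
  by rewrite addr0 scalemxAl.
- move=> g; split=> [/eqP|[u [v ->]]].
    rewrite -submxE => /WP[v vE]; pose d := pull c g - hh * pull c v.
    have vd : vanishes (N + m) d.
      apply/truncation_eq0; rewrite /d -[_ - _]addrC -mulN1r -(rmorphN1 (@fpsC K)).
      by rewrite truncation_lin scaleN1r vE addNr.
    have [w wE] := has_order_dvd hm (vanishesW (leq_addl N m) vd).
    have /high[g' g'E] : vanishes N w.
      have [->|/has_order_exists[k wk]] := eqVneq w 0; first by [].
      have := vd; rewrite wE => /(vanishes_order (has_orderM wk hm)).
      by rewrite leq_add2r => le_Nk; apply: vanishesW le_Nk wk.2.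
    have [|u uE] := ker (g - (v + g') * h).
      by rewrite rmorphB rmorphM rmorphD g'E mulrDl -/hh -wE /d; ring.
    by exists u, (v + g'); rewrite -uE subrK.
  apply/eqP; rewrite -submxE; apply/WP; exists v.
  by rewrite rmorphD !rmorphM f0 mulr0 add0r mulrC.
- move=> v; split=> [/submxP[x ->]|[g <-]].
    have /UP[g gE] : (x *m U <= U)%MS by apply: submxMl.
    by exists g; rewrite /L gE mulmxA.
  by rewrite submxMr //; apply/UP; exists g.
Qed.

End Intersection.

(** * The tangent of the branch *)

(** Characteristic zero, in a form that passes from the coefficients to the
    series. *)
Definition torsion_free (V : zmodType) := forall (x : V) n, x *+ n.+1 = 0 -> x = 0.

Lemma fps_torsion_free (R : comNzRingType) :
  torsion_free R -> torsion_free (fps R).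
Proof.
move=> R0 a n an0; apply/fpsP => i; apply: (R0 _ n).
by rewrite -fps_coefMn an0.
Qed.

Lemma has_order_deriv (R : comNzRingType) (a : fps R) n : torsion_free R ->
  has_order a n.+1 -> has_order (fps_deriv a) n.
Proof.
move=> R0 [an va]; split=> [|m lt_mn]; last by rewrite /= va ?mul0rn.
by apply: contraNneq an => /= /R0 ->.
Qed.

(** Derivation lowers the order of a series by one, unless this order is
    zero. *)
Lemma deriv_dvd_coef0 (R : comNzRingType) (a u : fps R) : torsion_free R ->
  a != 0 -> fps_deriv a = u * a -> a 0%N != 0.
Proof.
move=> R0 /has_order_exists[[|n] an] aE; first by case: an.
have [+ _] := has_order_deriv R0 an; rewrite aE.
have u0 : vanishes 0 u by [].
by rewrite (vanishesM u0 an.2 (ltnSn n)) eqxx.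
Qed.

Section Tangent.
Variable K : fieldType.
Implicit Types (f g : fps2 K) (gamma : formal_arc K).

Lemma dx_swap f : dx f = swap (dy (swap f)).
Proof. by rewrite swap_dy swapK. Qed.

Lemma dyD f g : dy (f + g) = dy f + dy g. Proof. exact: fps_derivD. Qed.
Lemma dyM f g : dy (f * g) = dy f * g + f * dy g. Proof. exact: fps_derivM. Qed.
Lemma dxD f g : dx (f + g) = dx f + dx g.
Proof. by rewrite !dx_swap rmorphD dyD rmorphD. Qed.
Lemma dxM f g : dx (f * g) = dx f * g + f * dx g.
Proof. by rewrite !dx_swap rmorphM dyM rmorphD !rmorphM /= !swapK. Qed.

Lemma swap_varX : swap (varX K) = varY K.
Proof.
by apply/fpsP => -[|[|j]]; apply/fpsP => -[|i].
Qed.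
Lemma swap_varY : swap (varY K) = varX K.
Proof. by rewrite -swap_varX swapK. Qed.

Lemma dy_varX : dy (varX K) = 0. Proof. exact: fps_derivC. Qed.
Lemma dy_varY : dy (varY K) = 1. Proof. exact: fps_derivX. Qed.
Lemma dx_varX : dx (varX K) = 1.
Proof. by rewrite dx_swap swap_varX dy_varY rmorph1. Qed.
Lemma dx_varY : dx (varY K) = 0.
Proof. by rewrite dx_swap swap_varY dy_varX rmorph0. Qed.
Lemma dy_const k : dy (fpsC (fpsC k) : fps2 K) = 0.
Proof. exact: fps_derivC. Qed.
Lemma dx_const k : dx (fpsC (fpsC k) : fps2 K) = 0.
Proof.
have -> : fpsC (fpsC k) = swap (fpsC (fpsC k)) by apply/fpsP => -[|j]; apply/fpsP => -[|i].
by rewrite dx_swap swapK dy_const rmorph0.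
Qed.

Lemma fps2_split f :
  exists g h, f = fpsC (fpsC (value0 f)) + varX K * g + varY K * h.
Proof.
exists (fpsC (fps_drop 1 (f 0%N))), (fps_drop 1 f).
by rewrite -rmorphM -rmorphD -fps_split -fps_split.
Qed.

Lemma vanishes_pull gamma (c : centered gamma) n g : value0 g = 0 ->
  vanishes n gamma.1 -> vanishes n gamma.2 -> vanishes n (pull c g).
Proof.
move=> g0 vx vy; have [a [b ->]] := fps2_split g.
rewrite g0 !rmorph0 add0r rmorphD !rmorphM pull_varX pull_varY.
by rewrite -[n]addn0; apply: vanishesD; apply: vanishesM => //; rewrite addn0.
Qed.

(** Both sides are derivations into the series ring along the restriction to
    the arc, with the same values on the coordinates.  Their difference
    vanishes on constants, hence maps [x g + y h] to a combination of its
    values at [g] and [h] with coefficients of positive order. *)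
Lemma pull_chain_rule gamma (c : centered gamma) f :
  fps_deriv (pull c f) =
  pull c (dx f) * fps_deriv gamma.1 + pull c (dy f) * fps_deriv gamma.2.
Proof.
pose E f := fps_deriv (pull c f) -
  (pull c (dx f) * fps_deriv gamma.1 + pull c (dy f) * fps_deriv gamma.2).
suff E0 : forall f, E f = 0 by apply/eqP; rewrite -subr_eq0; apply/eqP/E0.
apply: vanishing_family => n vE {}f; have [g [h fE]] := fps2_split f.
have -> : E f = gamma.1 * E g + gamma.2 * E h.
  rewrite /E fE !dxD !dyD !dxM !dyM dx_const dy_const dx_varX dx_varY dy_varX dy_varY.
  rewrite !mul0r !mul1r !add0r !rmorphD !rmorphM pull_const pull_varX pull_varY.
  by rewrite !fps_derivD fps_derivC !fps_derivM; ring.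
rewrite -add1n; apply: vanishesD; apply: vanishesM; try exact: vE.
  by case=> // _; exact: c.1.
by case=> // _; exact: c.2.
Qed.

(** A nonzero series dividing its derivative has a nonzero constant
    coefficient.  Used for the variable [y] and then for [x], this makes [f]
    a unit. *)
Lemma irreducible_gradient f : torsion_free K -> irreducible_elt f ->
  ~ ((exists u, dx f = u * f) /\ (exists v, dy f = v * f)).
Proof.
move=> K0 firr [[u fx] [v fy]].
have f0 := deriv_dvd_coef0 (fps_torsion_free K0) (irreducible_neq0 firr) fy.
have f00 : f 0%N 0%N != 0.
  apply: (deriv_dvd_coef0 (u := u 0%N) K0 f0).
  by rewrite -fps_coef0M -fx.
by case: firr => /negP[]; do 2![apply: fps_unit0]; rewrite unitfE.
Qed.

(** * Primitive parametrizations of a non-singular branch *)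

Lemma fps_compX (a : fps K) : fps_comp a fpsX = a.
Proof.
apply/fpsP => n; rewrite /= big_ord_recr /= -[fpsX ^+ n]mulr1 fpsXn_coefM.
rewrite ltnn subnn mulr1 big1 ?add0r // => i _.
rewrite -[fpsX ^+ i]mulr1 fpsXn_coefM ltnNge ltnW //=.
by have := ltn_ord i; rewrite -subn_gt0; case: (n - i)%N => // k _; rewrite mulr0.
Qed.

(** The arc is [(phi(t), t)] where [phi(y)] is the remainder of the division
    of [x] by [f]. *)
Lemma nonsingular_param_y f : value0 f = 0 -> value0 (dx f) != 0 ->
  exists gamma, primitive_parametrization f gamma /\ gamma.2 = fpsX.
Proof.
move=> f0 fx; have f01 : has_order (f 0%N) 1 by split=> // -[].
have [q [r [xE r_low]]] := weierstrass_division f01 (varX K).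
have coefE i : fpsX i = (q 0%N * f 0%N) i + r 0%N i.
  by rewrite -fps_coef0M -!fps_coefD -xE.
pose phi : fps K := Fps (fun n => r n 0%N).
have rE : r = swap (fpsC phi).
  apply/fpsP => -[|n]; apply/fpsP => -[|k] //=; exact: r_low.
have c : centered (phi, fpsX : fps K).
  split=> //=; have := coefE 0%N.
  by rewrite fps_coef0M -[f 0%N 0%N]/(value0 f) f0 mulr0 add0r => <-.
have q0 : value0 q != 0.
  have := coefE 1%N; rewrite r_low // addr0 fps_coefM !big_ord_recl big_ord0 /=.
  rewrite -[f 0%N 0%N]/(value0 f) f0 mulr0 !addr0 => q1.
  by apply/eqP => q0; move/eqP: q1; rewrite -[q 0%N 0%N]/(value0 q) q0 mul0r oner_eq0.
exists (phi, fpsX); split=> //; split=> //.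
- by apply: contraNneq (fpsX_neq0 K) => /(congr1 snd) /= ->.
- rewrite (pullbackE c); apply/eqP; apply: contraNT q0 => f_neq0.
  have : pull c (varX K) = pull c q * pull c f + pull c r.
    by rewrite xE rmorphD rmorphM.
  have -> : pull c r = phi.
    by rewrite rE -(pull_swap c) swapK pull_comp fps_compX.
  rewrite pull_varX => /eqP; rewrite -subr_eq subrr eq_sym mulf_eq0 (negPf f_neq0) orbF.
  by move=> /eqP pq0; rewrite -(pull_coef0 c) pq0.
move=> delta tau cdelta tau0 /(congr1 snd) /= XE.
have X1 : has_order (fpsX : fps K) 1 by split; [rewrite oner_neq0 | case].
pose w := fps_subst (@fpsC K) tau0 (fps_drop 1 delta.2).
have XE' : fpsX = tau * w.
  rewrite XE (fps_compE _ tau0) [delta.2 in LHS]fps_split cdelta.2 rmorph0 add0r.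
  by rewrite rmorphM /= fps_substX.
have := fpsX_neq0 K; rewrite {1}XE' mulf_eq0 negb_or => /andP[].
move=> /has_order_exists[k tk] /has_order_exists[m wm]; rewrite (fps_ordE tk).
have := has_orderM tk wm; rewrite -XE' => /(has_order_uniq X1).
by case: k tk => [[]|[|k] _] //; rewrite tau0 eqxx.
Qed.

Lemma primitive_swap f gamma :
  primitive_parametrization (swap f) gamma ->
  primitive_parametrization f (swap_arc gamma).
Proof.
case=> [c gamma_neq0 f0 prim]; split.
- exact: centered_swap.
- by apply: contraNneq gamma_neq0 => -[y0 x0]; rewrite [gamma]surjective_pairing x0 y0.
- by rewrite -f0 -[in LHS](swapK f) pullback_swap.
move=> delta tau cdelta tau0 [yE xE].
apply: (prim (swap_arc delta)) => //; first exact: centered_swap.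
by rewrite [gamma]surjective_pairing xE yE.
Qed.

End Tangent.

(** * The multiplicity along a separatrix *)

(** The series [q] is divisible by [u] for reasons of order, and the relation
    makes [- q / u] the quotient of [p] by [v] as well. *)
Lemma common_quotient (K : fieldType) (u v p q : fps K) n :
  p * u + q * v = 0 -> has_order u n -> vanishes n q ->
  exists t, t * u = - q /\ t * v = p.
Proof.
move=> pq un vq; have [t qE] := has_order_dvd un vq.
have u_neq0 := has_order_neq0 un; exists (- t); split; first by rewrite mulNr -qE.
apply: (mulIf u_neq0); apply/eqP; rewrite -subr_eq0 -oppr_eq0; apply/eqP.
by rewrite -pq qE; ring.
Qed.

Section Separatrix.
Variables (K : fieldType) (F : foliation K) (f : fps2 K).
Hypotheses (K0 : torsion_free K) (sep : separatrix F f).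
Let P := fol_P F.
Let Q := fol_Q F.
Let firr : irreducible_elt f := sep.1.
Implicit Types gamma : formal_arc K.

Section Branch.
Variable gamma : formal_arc K.
Hypothesis prim : primitive_parametrization f gamma.

Let c : centered gamma. Proof. by case: prim. Qed.
Let gamma_neq0 : gamma != (0, 0). Proof. by case: prim. Qed.
Let f0 : pull c f = 0. Proof. by case: prim => _ _ + _; rewrite (pullbackE c). Qed.

Lemma branch_eq0 g : pullback g gamma = 0 <-> exists u, g = u * f.
Proof.
rewrite (pullbackE c); split=> [|[u ->]]; first exact: pull_kernel.
by rewrite rmorphM f0 mulr0.
Qed.

Lemma branch_coprime g : relatively_prime g f <-> pullback g gamma != 0.
Proof.
rewrite irreducible_coprime // -branch_eq0.
by split=> [/eqP|/eqP].
Qed.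

Lemma branch_intersection g n :
  has_order (pullback g gamma) n -> intersection_number f g = n%:Z%:E.
Proof. by rewrite (pullbackE c); apply: intersection_number_order prim. Qed.

Let p := pull c P.
Let q := pull c Q.
Let a := pull c (dx f).
Let b := pull c (dy f).
Let x' := fps_deriv gamma.1.
Let y' := fps_deriv gamma.2.

Let tangent : a * x' + b * y' = 0.
Proof. by rewrite -pull_chain_rule f0 raddf0. Qed.

Let gradient : a != 0 \/ b != 0.
Proof.
apply/orP; rewrite -negb_and; apply/andP => -[/eqP a0 /eqP b0].
apply: (irreducible_gradient K0 firr).
by split; apply/branch_eq0; rewrite (pullbackE c).
Qed.

Let invariance : p * b = q * a.
Proof.
have [h hE] := sep.2; apply/eqP; rewrite -subr_eq0 -!rmorphM -rmorphB.
by rewrite hE rmorphM f0 mul0r.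
Qed.

Let field_tangent : p * x' + q * y' = 0.
Proof.
have ta : a * (p * x' + q * y') = 0.
  have -> : a * (p * x' + q * y') = p * (a * x' + b * y') - (p * b - q * a) * y'.
    by ring.
  by rewrite tangent invariance subrr mulr0 mul0r subr0.
have tb : b * (p * x' + q * y') = 0.
  have -> : b * (p * x' + q * y') = q * (a * x' + b * y') + (p * b - q * a) * x'.
    by ring.
  by rewrite tangent invariance subrr mulr0 mul0r addr0.
by case: gradient => /mulfI; apply; rewrite ?ta ?tb mulr0.
Qed.

Lemma coordinate_order (z : fps K) : z 0%N = 0 -> z != 0 ->
  exists n, has_order z n.+1.
Proof.
move=> z0 /has_order_exists[[|n] zn]; last by exists n.
by case: zn; rewrite z0 eqxx.
Qed.

(** The field is pulled back by dividing by the derivative of the coordinate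
    of smallest order, which is possible as the components of the field have
    no constant term. *)
Lemma field_lifts : exists theta, lifts_field F gamma theta.
Proof.
have : (exists n, has_order gamma.1 n.+1 /\ vanishes n.+1 gamma.2) \/
       (exists n, has_order gamma.2 n.+1 /\ vanishes n.+1 gamma.1).
  have [x0|/(coordinate_order c.1)[n xn]] := eqVneq gamma.1 0.
    have [|m ym] := @coordinate_order gamma.2 c.2.
      by apply: contraNneq gamma_neq0 => y0; rewrite [gamma]surjective_pairing x0 y0.
    by right; exists m; rewrite x0; split.
  have [y0|/(coordinate_order c.2)[m ym]] := eqVneq gamma.2 0.
    by left; exists n; rewrite y0; split.
  case: (leqP n m) => [le_nm|lt_mn].
    by left; exists n; split=> //; apply: vanishesW ym.2.
  by right; exists m; split=> //; apply: vanishesW xn.2; apply: ltnW.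
case=> -[n [zn vz]].
  have vq : vanishes n q.
    by apply/(vanishesW (leqnSn n))/vanishes_pull => //; [exact: fol_Q0 | exact: zn.2].
  have [t tE] := common_quotient field_tangent (has_order_deriv K0 zn) vq.
  by exists t; rewrite /lifts_field !(pullbackE c).
have vp : vanishes n p.
  by apply/(vanishesW (leqnSn n))/vanishes_pull => //; [exact: fol_P0 | exact: zn.2].
have [|t [ty tx]] := @common_quotient _ y' x' q p n _ (has_order_deriv K0 zn) vp.
  by rewrite addrC field_tangent.
by exists (- t); rewrite /lifts_field !(pullbackE c) !mulNr ty tx opprK.
Qed.

(** With [f_y] (or [f_x]) for [g], the coefficient of [df] is [Q] (or [P]), as
    [P f_y - Q f_x] is divisible by [f]. *)
Lemma decomposition_exists : exists gh, gsv_decomposition F f gh.1 gh.2.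
Proof.
have [h hE] := sep.2; rewrite -/P -/Q in hE.
have f_not_unit : f \isn't a GRing.unit by case: firr.
have pq_neq0 : ~ (p = 0 /\ q = 0).
  rewrite /p /q -!(pullbackE c) !branch_eq0 => -[[u PE] [v QE]].
  by case/negP: f_not_unit; apply: (@fol_coprime _ F f u v); rewrite mulrC.
have [b0|b_neq0] := eqVneq b 0.
  have a_neq0 : a != 0 by case: gradient; rewrite ?b0 ?eqxx.
  exists (dx f, P); split; [by apply/branch_coprime; rewrite (pullbackE c) | |].
  - apply/branch_coprime; rewrite (pullbackE c) -/p; apply/eqP => p0.
    apply: pq_neq0; split=> //; apply: (mulIf a_neq0).
    by rewrite -invariance p0 !mul0r.
  - exists 0, (- h); split=> /=; first by rewrite mulr0 addr0 mulrC.
    by rewrite mulrN -hE /P /Q; ring.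
exists (dy f, Q); split; [by apply/branch_coprime; rewrite (pullbackE c) | |].
- apply/branch_coprime; rewrite (pullbackE c) -/q; apply/eqP => q0.
  apply: pq_neq0; split=> //; apply: (mulIf b_neq0).
  by rewrite invariance q0 !mul0r.
exists h, 0; split=> /=; last by rewrite mulr0 addr0 mulrC.
by rewrite -hE /P /Q; ring.
Qed.

(** On the branch, [g P = h f_x] and [g Q = h f_y].  With [theta y'] for [P]
    and [- theta x'] for [Q], these are identities of series in one variable,
    and the orders of both sides are compared; [x'] has order one less than
    [x]. *)
Lemma order_identity g h theta :
  gsv_decomposition F f g h -> lifts_field F gamma theta ->
  exists G H T, [/\ has_order (pullback g gamma) G,
    has_order (pullback h gamma) H, has_order theta T,
    forall m, has_order gamma.1 m -> exists B,
      has_order (pullback (dy f) gamma) B /\ (G + T + m = H + B + 1)%N &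
    forall m, has_order gamma.2 m -> exists A,
      has_order (pullback (dx f) gamma) A /\ (G + T + m = H + A + 1)%N].
Proof.
move=> [/branch_coprime g_neq0 /branch_coprime h_neq0 [e1 [e2 [gP gQ]]]].
rewrite /lifts_field !(pullbackE c) in g_neq0 h_neq0 * => -[tx ty].
have [G gG] := has_order_exists g_neq0; have [H hH] := has_order_exists h_neq0.
have gpE : pull c g * p = pull c h * a.
  by rewrite -!rmorphM gP rmorphD [pull c (f * _)]rmorphM f0 mul0r addr0.
have gqE : pull c g * q = pull c h * b.
  by rewrite -!rmorphM gQ rmorphD [pull c (f * _)]rmorphM f0 mul0r addr0.
have xE : pull c g * theta * x' = - (pull c h * b).
  by rewrite -mulrA tx mulrN gqE.
have yE : pull c g * theta * y' = pull c h * a.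
  by rewrite -mulrA ty gpE.
have theta_neq0 : theta != 0.
  apply/eqP => t0; move: xE yE; rewrite t0 mulr0 !mul0r => /eqP + /esym/eqP.
  rewrite eq_sym oppr_eq0 !mulf_eq0 (negPf h_neq0) /= => /eqP b0 /eqP a0.
  by case: gradient; rewrite ?a0 ?b0 eqxx.
have [T tT] := has_order_exists theta_neq0; exists G, H, T; split=> // m zm.
- have [[|n] xn] : exists n, has_order gamma.1 n by exists m.
    by case: xn; rewrite c.1 eqxx.
  rewrite (has_order_uniq zm xn) {m zm}; have x'n := has_order_deriv K0 xn.
  have lhs := has_orderM (has_orderM gG tT) x'n.
  have b_neq0 : b != 0.
    by apply: contraTneq (has_order_neq0 lhs) => b0; rewrite xE b0 mulr0 oppr0 eqxx.
  have [B bB] := has_order_exists b_neq0; exists B; split=> //.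
  have [l1 l2] := lhs; rewrite xE in l1 l2.
  have lhs' : has_order (pull c h * b) (G + T + n).
    split=> [|k lt_k]; first by rewrite -oppr_eq0.
    by apply: oppr_inj; rewrite oppr0 -[RHS](l2 k lt_k).
  by rewrite addnS (has_order_uniq lhs' (has_orderM hH bB)) addn1.
have [[|n] yn] : exists n, has_order gamma.2 n by exists m.
  by case: yn; rewrite c.2 eqxx.
rewrite (has_order_uniq zm yn) {m zm}; have y'n := has_order_deriv K0 yn.
have lhs := has_orderM (has_orderM gG tT) y'n; rewrite yE in lhs.
have a_neq0 : a != 0.
  by apply: contraTneq (has_order_neq0 lhs) => a0; rewrite a0 mulr0 eqxx.
have [A aA] := has_order_exists a_neq0; exists A; split=> //.
by rewrite addnS (has_order_uniq lhs (has_orderM hH aA)) addn1.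
Qed.

End Branch.

(** Orders along a primitive arc are intersection numbers, so all primitive
    arcs of the branch give the same. *)
Lemma branch_order_indep gamma gamma' g n :
  primitive_parametrization f gamma -> primitive_parametrization f gamma' ->
  has_order (pullback g gamma) n -> has_order (pullback g gamma') n.
Proof.
move=> prim prim' gn.
have g_neq0 : pullback g gamma' != 0.
  by apply/(branch_coprime prim')/(branch_coprime prim)/has_order_neq0/gn.
have [n' gn'] := has_order_exists g_neq0.
have := branch_intersection prim' gn'; rewrite (branch_intersection prim gn).
by case=> ->.
Qed.

Theorem multiplicity_formula gamma : primitive_parametrization f gamma ->
  (gamma.1 <> 0 ->
     multiplicity_along F f =
     (gsv_index F f + fps_ord (pullback (dy f) gamma) - fps_ord gamma.1 + 1)%E) /\
  (gamma.2 <> 0 ->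
     multiplicity_along F f =
     (gsv_index F f + fps_ord (pullback (dx f) gamma) - fps_ord gamma.2 + 1)%E).
Proof.
move=> prim; rewrite /multiplicity_along /gsv_index /=.
set gamma0 := xget (0, 0) _; set theta := xget 0 _; set gh := xget (0, 0) _.
have prim0 : primitive_parametrization f gamma0.
  by apply: (xgetPex (P := primitive_parametrization f) (0, 0)); exists gamma.
have lift : lifts_field F gamma0 theta.
  exact: (xgetPex (P := lifts_field F gamma0) 0 (field_lifts prim0)).
have dec : gsv_decomposition F f gh.1 gh.2.
  exact: (xgetPex (P := fun gh => gsv_decomposition F f gh.1 gh.2) (0, 0)
    (decomposition_exists prim)).
have [G [H [T [gG hH tT xP yP]]]] := order_identity prim0 dec lift.
rewrite (branch_intersection prim0 gG) (branch_intersection prim0 hH) (fps_ordE tT).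
have [c _ _ _] := prim; have [c0 _ _ _] := prim0.
split=> /eqP/has_order_exists[m zm]; rewrite (fps_ordE zm).
  have := @branch_order_indep gamma gamma0 (varX K) m prim prim0.
  rewrite (pullback_varX c) (pullback_varX c0) => /(_ zm)/xP[B [bB GTm]].
  rewrite (fps_ordE (branch_order_indep prim0 prim bB)).
  by rewrite -[RHS]/((H%:Z - G%:Z + B%:Z - m%:Z + 1)%:E); congr (_%:E); lia.
have := @branch_order_indep gamma gamma0 (varY K) m prim prim0.
rewrite (pullback_varY c) (pullback_varY c0) => /(_ zm)/yP[A [aA GTm]].
rewrite (fps_ordE (branch_order_indep prim0 prim aA)).
by rewrite -[RHS]/((H%:Z - G%:Z + A%:Z - m%:Z + 1)%:E); congr (_%:E); lia.
Qed.

Lemma multiplicity_nonsingular : nonsingular f ->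
  multiplicity_along F f = gsv_index F f.
Proof.
have X1 : has_order (fpsX : fps K) 1 by split; [rewrite oner_neq0 | case].
have X_neq0 := has_order_neq0 X1.
have cancel (z : \bar int) : (z + 0%:E - 1%N%:Z%:E + 1)%E = z.
  by case: z => [z||] //; rewrite -[LHS]/((z + 0 - 1 + 1)%:E); congr (_%:E); lia.
have f0 : value0 f = 0.
  apply/eqP; case: firr => + _; apply: contraNT => f0.
  by do 2![apply: fps_unit0]; rewrite unitfE.
case=> [fx|fy].
  have [gamma [prim yE]] := nonsingular_param_y f0 fx.
  have [_ formula] := multiplicity_formula prim.
  rewrite formula yE; last exact/eqP.
  rewrite (fps_ordE X1); have [c _ _ _] := prim.
  rewrite (pullbackE c) (@fps_ordE _ _ 0) ?cancel //.
  by apply: has_order0; rewrite pull_coef0.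
have fx : value0 (dx (swap f)) != 0 by rewrite -swap_dy.
have [gamma [/primitive_swap prim yE]] := nonsingular_param_y (f := swap f) f0 fx.
have xE : (swap_arc gamma).1 = fpsX := yE.
have [formula _] := multiplicity_formula prim.
rewrite formula xE; last exact/eqP.
rewrite (fps_ordE X1); have [c _ _ _] := prim.
rewrite (pullbackE c) (@fps_ordE _ _ 0) ?cancel //.
by apply: has_order0; rewrite pull_coef0.
Qed.

End Separatrix.

Theorem proposition5p7 (R : realType) (F : foliation R[i]) (f : fps2 R[i])
  (hf : separatrix F f) :
  (forall gamma : formal_arc R[i], primitive_parametrization f gamma ->
     (gamma.1 <> 0 ->
        multiplicity_along F f =
        (gsv_index F f + fps_ord (pullback (dy f) gamma) - fps_ord gamma.1 + 1)%E) /\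
     (gamma.2 <> 0 ->
        multiplicity_along F f =
        (gsv_index F f + fps_ord (pullback (dx f) gamma) - fps_ord gamma.2 + 1)%E)) /\
  (nonsingular f -> multiplicity_along F f = gsv_index F f).
Proof.
have C0 : torsion_free R[i] by move=> x n /eqP; rewrite mulrn_eq0 => /eqP.
by split=> [gamma|]; [apply: multiplicity_formula | apply: multiplicity_nonsingular].
Qed.
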